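(* Let $X,Y$ be different rays in $V$, and let $S$ be a convex subset of the closed interval $[X,Y]$. Then the set of all rays $W$ in $V$ with $W\notin\{X,Y\}^{\perp}$ and $M_W(X,Y)\in S$ is convex in $\mathrm{Ray}(V)$.
   Context: A supertropical semiring is a commutative semiring $R$ such that $e:=1+1$ satisfies $e+e=e$ and, for all $a,b\in R$: $a+b\in\{a,b\}$ if $ea\ne eb$, and $a+b=ea$ if $ea=eb$. Assume $R$ is a supertropical semiring without zero divisors, $V$ is an $R$-module with $\lambda x\neq0$ for all nonzero $\lambda\in R$ and nonzero $x\in V$, and $(q,b)$ is a quadratic pair on $V$: $q:V\to R$ with $q(ax)=a^2q(x)$, and $b:V\times V\to R$ symmetric bilinear with $q(x+y)=q(x)+q(y)+b(x,y)$. Rays: $x\sim x'$ in $V\setminus\{0\}$ iff $\lambda x=\lambda' x'$ for some $\lambda,\lambda'\in R\setminus\{0\}$; the classes are the rays, $\mathrm{ray}(x)$ is the class of $x$, and $\mathrm{Ray}(V)$ is the set of rays. For $X=\mathrm{ray}(x)$, $Y=\mathrm{ray}(y)$ the closed interval $[X,Y]$ is the set of all rays contained in the submodule $(X\cup\{0\})+(Y\cup\{0\})$ of $V$. A subset $A\subset\mathrm{Ray}(V)$ is convex if $[X,Y]\subset A$ for all $X,Y\in A$. The polar $C^\perp$ of $C\subset\mathrm{Ray}(V)$ is the set of all rays $W$ with $b(w,x)=0$ for all $w\in W$ and all $x\in V\setminus\{0\}$ with $\mathrm{ray}(x)\in C$. For rays $W=\mathrm{ray}(w)$, $X=\mathrm{ray}(x)$,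 $Y=\mathrm{ray}(y)$ with $W\notin\{X,Y\}^\perp$, the $W$-median of $(X,Y)$ is the (well defined) ray $M_W(X,Y):=\mathrm{ray}\bigl(b(w,y)x+b(w,x)y\bigr)\in[X,Y]$.
   Formalization: The closed interval [X,Y] is taken to be the set of rays ray(z) with z a nonzero vector of (X∪{0})+(Y∪{0}), instead of rays contained in it as subsets; under literal containment medians can lie outside [X,Y] and the claim fails. *)

(* Defs.v *)
From HB Require Import structures.
From mathcomp Require Import all_boot all_order all_algebra.
From mathcomp Require Import boolp classical_sets.

Set Implicit Arguments.
Unset Strict Implicit.
Unset Printing Implicit Defensive.

Import GRing.Theory.

Local Open Scope classical_set_scope.
Local Open Scope ring_scope.

Section Supertropical.
Variable R : comPzSemiRingType.

Definition supertropical : Prop :=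
  let e : R := 1 + 1 in
  [/\ e + e = e,
      forall a b : R, e * a <> e * b -> a + b = a \/ a + b = b &
      forall a b : R, e * a = e * b -> a + b = e * a].

Definition no_zero_divisors : Prop :=
  forall a b : R, a * b = 0 -> a = 0 \/ b = 0.

End Supertropical.

Section RaySpace.
Context {R : comPzSemiRingType} {V : lSemiModType R}.

Definition scale_nonzero : Prop :=
  forall (l : R) (x : V), l <> 0 -> x <> 0 -> l *: x <> 0.

Definition quadratic_pair (q : V -> R) (b : V -> V -> R) : Prop :=
  [/\ forall (a : R) (x : V), q (a *: x) = a ^+ 2 * q x,
      forall x y, b x y = b y x,
      forall x, {morph b x : y z / y + z} /\ GRing.scalable_for *%R (b x),
      forall y, {morph b^~ y : x z / x + z} /\ GRing.scalable_for *%R (b^~ y) &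
      forall x y, q (x + y) = q x + q y + b x y].

Definition ray_equiv (x y : V) : Prop :=
  exists l m : R, [/\ l <> 0, m <> 0 & l *: x = m *: y].

Definition ray (x : V) : set V := [set y | y <> 0 /\ ray_equiv x y].

(* A ray is an equivalence class, i.e. a subset of V \ {0}, so a set of rays
   is an element of [set (set V)] included in [Ray]. *)
Definition Ray : set (set V) := [set X | exists2 x : V, x <> 0 & X = ray x].

Definition ray0 (X : set V) : set V := X `|` [set 0].

(* The rays of the submodule X_0 + Y_0, as elements of Ray(V): the rays of V
   represented by a nonzero vector of X_0 + Y_0. Beware that such a ray need
   not be included in X_0 + Y_0 as a subset of V. Over R = {0, 1, e} let V be
   the submodule of R^2 consisting of 0, x = (e, 0), y = (0, e) and the four
   vectors with both coordinates nonzero: ray (x + y) contains z = (1, 1),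
   since e z = x + y, but ray0 (ray x) + ray0 (ray y) = {0, x, y, x + y}.
   Literal inclusion would thus exclude ray (x + y), hence also medians, from
   [X, Y]. *)
Definition ray_interval (X Y : set V) : set (set V) :=
  [set ray z | z in [set x + y | x in ray0 X & y in ray0 Y] `\ 0].

Definition ray_convex (A : set (set V)) : Prop :=
  A `<=` Ray /\ forall X Y, A X -> A Y -> ray_interval X Y `<=` A.

Definition ray_polar (b : V -> V -> R) (C : set (set V)) : set (set V) :=
  [set W | Ray W /\
    forall w x : V, W w -> x <> 0 -> C (ray x) -> b w x = 0].

Definition ray_repr (X : set V) : V := xget 0 X.

(* Representatives are picked by choice; [medianE] shows that the result does
   not depend on them. *)
Definition ray_median (b : V -> V -> R) (W X Y : set V) : set V :=
  let w := ray_repr W in let x := ray_repr X in let y := ray_repr Y in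
  ray (b w y *: x + b w x *: y).

Lemma ray_equiv_sym (x y : V) : ray_equiv x y -> ray_equiv y x.
Proof. by move=> [l [m [? ? e]]]; exists m, l; split. Qed.

Lemma ray_equiv_trans (x y z : V) : no_zero_divisors R ->
  ray_equiv x y -> ray_equiv y z -> ray_equiv x z.
Proof.
move=> nzd [l [m [l0 m0 e]]] [l' [m' [l'0 m'0 e']]].
exists (l' * l), (m * m'); split; [by case/nzd | by case/nzd |].
by rewrite -!scalerA e -e' !scalerA mulrC.
Qed.

Lemma eq_ray (x y : V) : no_zero_divisors R -> ray_equiv x y -> ray x = ray y.
Proof.
move=> nzd exy; apply/seteqP; split=> z [z0 e]; split=> //.
  by apply: ray_equiv_trans e => //; apply: ray_equiv_sym.
exact: ray_equiv_trans e.
Qed.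

Lemma ray_refl (x : V) : no_zero_divisors R -> x <> 0 -> ray x x.
Proof.
move=> nzd x0; split=> //; exists 1, 1; split=> //;
  by move=> e; apply: x0; rewrite -[x]scale1r e scale0r.
Qed.

Lemma ray_reprP (x : V) : no_zero_divisors R -> x <> 0 ->
  ray_equiv x (ray_repr (ray x)).
Proof.
by move=> nzd x0; case: (xgetI 0 (ray_refl nzd x0)).
Qed.

Lemma medianE (q : V -> R) (b : V -> V -> R) (w x y : V) :
  no_zero_divisors R -> quadratic_pair q b -> w <> 0 -> x <> 0 -> y <> 0 ->
  ray_median b (ray w) (ray x) (ray y) = ray (b w y *: x + b w x *: y).
Proof.
move=> nzd [_ _ bl br _] w0 x0 y0; symmetry; apply: eq_ray => //.
have [l [l' [l0 l'0 e]]] := ray_reprP nzd w0.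
have [m [m' [m0 m'0 f]]] := ray_reprP nzd x0.
have [n [n' [n0 n'0 g]]] := ray_reprP nzd y0.
set w' := ray_repr _ in e *; set x' := ray_repr _ in f *; set y' := ray_repr _ in g *.
have bZ a c u v : b (a *: u) (c *: v) = a * c * b u v.
  by rewrite (br _).2 (bl _).2 mulrA.
have key a c d u v t : (a * c * d) *: (b t v *: u + b t u *: v) =
    b (a *: t) (d *: v) *: (c *: u) + b (a *: t) (c *: u) *: (d *: v).
  rewrite scalerDr !scalerA !bZ; congr (_ *: _ + _ *: _).
    by rewrite [RHS]mulrAC [a * d * c]mulrAC.
  by rewrite [RHS]mulrAC.
exists (l * m * n), (l' * m' * n'); split;
  [by case/nzd => [/nzd[]|] | by case/nzd => [/nzd[]|] |].
by rewrite !key e f g.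
Qed.

End RaySpace.

Arguments Ray {R} V.
Arguments scale_nonzero {R} V.

(* Main.v *)
(* Medians are additive in W: with m_W(w) = b(w,y) x + b(w,x) y one has
   m(w1 + w2) = m(w1) + m(w2), so the median of a ray in [W1, W2] lies in
   [M_W1, M_W2]. The vectors involved are nonzero because a supertropical
   semiring satisfies 3 = 2, hence sums in R and V vanish only trivially. *)
Require Import Defs.
From mathcomp Require Import all_boot all_order all_algebra.
From mathcomp Require Import boolp classical_sets.

Local Open Scope classical_set_scope.
Local Open Scope ring_scope.

Import GRing.Theory.

(** With [e = 1 + 1], both [e * 1] and [e * e = e + e] equal [e], so [1] and [e] fall under the
    ghost case of addition, whose value here is [e]. *)
Lemma supertropical_3_eq_2 {R : comPzSemiRingType} :
  supertropical R -> 1 + (1 + 1) = 1 + 1 :> R.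
Proof.
move=> [e_idem _ add_ghost].
rewrite (add_ghost 1 (1 + 1)) mulr1 // mulrDr mulr1.
by rewrite e_idem.
Qed.

(** Scaling 3 = 2 by [x] gives 3x = 2x; adding 2y to both sides turns 2x into 2(x + y) = 0 and
    leaves x = 0. *)
Lemma supertropical_addr_eq0 {R : comPzSemiRingType} {V : lSemiModType R}
    {x y : V} : supertropical R -> x + y = 0 -> x = 0.
Proof.
move=> R_st xy0.
have x32 : x + (x + x) = x + x.
  have := congr1 ( *:%R^~ x) (supertropical_3_eq_2 R_st).
  by rewrite !scalerDl !scale1r.
have xy20 : (x + x) + (y + y) = 0 by rewrite addrACA xy0 addr0.
have := congr1 (+%R^~ (y + y)) x32.
by rewrite /= -[LHS]addrA xy20 addr0.
Qed.

Lemma Ray_mem {R : comPzSemiRingType} {V : lSemiModType R} {W : set V} {w : V} :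
  no_zero_divisors R -> Ray V W -> W w -> w <> 0 /\ W = ray w.
Proof. by move=> R_nzd [x _ ->] [w0 exw]; split=> //; apply: eq_ray. Qed.

(** Bilinearity pulls the nonzero scalars relating the representatives out of [b], and they cancel
    for lack of zero divisors. *)
Lemma ray_orthogonal {R : comPzSemiRingType} {V : lSemiModType R}
    {q : V -> R} {b : V -> V -> R} {w x w' x' : V} :
  no_zero_divisors R -> quadratic_pair q b ->
  ray_equiv w w' -> ray_equiv x x' -> b w x = 0 -> b w' x' = 0.
Proof.
move=> R_nzd [_ _ br bl _] [l [m [_ m0 ew]]] [n [p [_ p0 ex]]] bwx0.
have : m * (p * b w' x') = 0.
  rewrite -(br _).2 -(bl _).2 -ew -ex (br _).2 (bl _).2 bwx0.
  by rewrite !mulr0.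
by case/R_nzd => // /R_nzd[].
Qed.

(** Lets the polar condition, quantified over all representatives, be tested on chosen vectors. *)
Lemma ray_polar_pair {R : comPzSemiRingType} {V : lSemiModType R}
    {q : V -> R} {b : V -> V -> R} {w x y : V} :
  no_zero_divisors R -> quadratic_pair q b -> w <> 0 -> x <> 0 -> y <> 0 ->
  ray_polar b [set ray x; ray y] (ray w) <-> b w x = 0 /\ b w y = 0.
Proof.
move=> R_nzd qb w0 x0 y0; split=> [[_ polar] | [bwx0 bwy0]].
  by split; apply: polar => //; [exact: ray_refl | left | exact: ray_refl | right].
split=> [|w' x' [_ ew] x'0]; first by exists w.
have rayK z : ray x' = ray z -> ray_equiv z x'.
  by move=> exz; have := ray_refl R_nzd x'0; rewrite exz => -[].
by case=> /rayK ex; apply: ray_orthogonal R_nzd qb ew ex _.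
Qed.

Theorem corollary7p6 (R : comPzSemiRingType) (V : lSemiModType R)
    (q : V -> R) (b : V -> V -> R) (X Y : set V) (S : set (set V))
    (R_supertropical : supertropical R) (R_nzd : no_zero_divisors R)
    (V_nonzero : scale_nonzero V) (qb : quadratic_pair q b)
    (X_ray : Ray V X) (Y_ray : Ray V Y) (X_neq_Y : X <> Y)
    (S_interval : S `<=` ray_interval X Y) (S_convex : ray_convex S) :
  ray_convex [set W | [/\ Ray V W, ~ ray_polar b [set X; Y] W &
                          S (ray_median b W X Y)]].
Proof.
split=> [W [] //|].
move=> W1 W2 W1_mem W2_mem Z [z [[u u_mem [v v_mem <-]] uv0] <-].
(* Either summand may be the zero adjoined by [ray0]: two zeros contradict [uv0], and a single one
   gives back the ray [W1] or [W2]. *)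
case: u_mem uv0 => [W1u | ->]; case: v_mem => [W2v | ->] uv0; last first.
- by case: uv0; rewrite /= addr0.
- rewrite add0r in uv0 *.
  by case: (W2_mem) => W2_ray _ _; have [_ <-] := Ray_mem R_nzd W2_ray W2v.
- rewrite addr0 in uv0 *.
  by case: (W1_mem) => W1_ray _ _; have [_ <-] := Ray_mem R_nzd W1_ray W1u.
have [x x0 eX] := X_ray; have [y y0 eY] := Y_ray; subst X Y.
have bDl t : {morph b^~ t : u v / u + v} by case: qb => _ _ _ /(_ t)[].
pose m w := b w y *: x + b w x *: y.
(* If [m w] is zero, so are both its summands; as [x] and [y] are nonzero, [V_nonzero] kills both
   coefficients, which makes the ray of [w] polar. *)
have nonzero_median w : w <> 0 -> ~ ray_polar b [set ray x; ray y] (ray w) ->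
    m w <> 0.
  move=> w0 /(ray_polar_pair R_nzd qb w0 x0 y0) npolar mw0.
  apply: npolar.
  have bwyx0 := supertropical_addr_eq0 R_supertropical mw0.
  rewrite /m addrC in mw0.
  have bwxy0 := supertropical_addr_eq0 R_supertropical mw0.
  by split; apply: contrapT => /V_nonzero nz; [apply: nz y0 _ | apply: nz x0 _].
case: W1_mem W2_mem => W1_ray + + [W2_ray + +].
have [u0 ->] := Ray_mem R_nzd W1_ray W1u.
have [v0 ->] := Ray_mem R_nzd W2_ray W2v.
rewrite !(medianE R_nzd qb) // => u_npolar Su v_npolar Sv.
have mu0 := nonzero_median u u0 u_npolar.
have mv0 := nonzero_median v v0 v_npolar.
split; first by exists (u + v).
  move=> /(ray_polar_pair R_nzd qb uv0 x0 y0).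
  rewrite !bDl => -[bx0 by0]; apply: u_npolar.
  apply/(ray_polar_pair R_nzd qb u0 x0 y0).
  (* [R^o] is [R] as a module over itself, so the vanishing of sums applies to values of [b]. *)
  by split; apply: (@supertropical_addr_eq0 R R^o) R_supertropical _; eassumption.
(* The median vector of [u + v] regroups as [m u + m v], with summands representing two rays of [S];
   it is nonzero because [m u] is. *)
rewrite (medianE R_nzd qb) // !bDl !scalerDl addrACA.
apply: (S_convex.2 _ _ Su Sv); exists (m u + m v) => //; split.
  exists (m u); first by left; apply: ray_refl.
  by exists (m v) => //; left; apply: ray_refl.
by move=> /(supertropical_addr_eq0 R_supertropical).
Qed.
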